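(* Let $\mathcal{X}$ be a nonsingular, projective, geometrically irreducible curve of genus $g\ge1$ over a finite field $\mathbb{F}_q$, let $m\ge1$ and let $P_0,P_1,\dots,P_m$ be distinct rational points on $\mathcal{X}$. Let $A=\sum_{\ell=0}^m a_\ell P_\ell$, where $(a_0,a_1,\ldots,a_m)\in\Gamma(P_0,P_1,\ldots,P_m)$. Let $\ell\in\{0,1,\ldots,m\}$. If $\mathcal{L}(A-P_\ell)=\mathcal{L}(A-2P_\ell)$, then $(a_0,a_1,\ldots,a_{\ell-1},a_\ell-1,a_{\ell+1},\ldots,a_m)$ is a pure gap of $H(P_0,P_1,\ldots,P_m)$.
   Context: For a divisor $G$ on $\mathcal{X}$, $\mathcal{L}(G)=\{f\in\mathbb{F}_q(\mathcal{X}) : (f)+G\ge0\}\cup\{0\}$ is the Riemann--Roch space. Weierstrass semigroup and gaps. For distinct rational points $R_1,\dots,R_r$ on $\mathcal{X}$, $H(R_1,\dots,R_r)=\{(u_1,\dots,u_r)\in\mathbb{N}_0^r : \exists f\in\mathbb{F}_q(\mathcal{X}) \text{ with pole divisor } (f)_\infty=\sum_i u_iR_i\}$, where $\mathbb{N}_0=\mathbb{N}\cup\{0\}$ and $\mathbb{N}$ is the set of positive integers; the gap set is $G(R_1,\dots,R_r)=\mathbb{N}_0^r\setminus H(R_1,\dots,R_r)$. Minimal generating set. On $\mathbb{N}_0^r$ let $\preceq$ be the componentwise partial order. For $\mathbf{u}=(u_1,\dots,u_r)\in\mathbb{N}_0^r$ and $1\le i\le r$, put $\nabla_i(\mathbf{u})=\{(p_1,\dots,p_r)\in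 H(R_1,\dots,R_r): p_i=u_i\}$. For $r\ge2$, $\Gamma(R_1,\dots,R_r)=\{\mathbf{u}\in\mathbb{N}^r : \mathbf{u}\text{ is minimal with respect to }\preceq\text{ in }\nabla_i(\mathbf{u})\text{ for some }i,\ 1\le i\le r\}$ (in particular $\mathbf{u}\in H(R_1,\dots,R_r)$). Pure gap. An element $(\alpha_1,\dots,\alpha_r)\in G(R_1,\dots,R_r)$ is a pure gap (of $H(R_1,\dots,R_r)$, or at $R_1,\dots,R_r$) if $\dim\mathcal{L}(\sum_{i}\alpha_iR_i)=\dim\mathcal{L}(\sum_{i}\alpha_iR_i-R_j)$ for all $j=1,\dots,r$. *)

(* Defs.v *)
From HB Require Import structures.
From mathcomp Require Import all_boot all_order all_algebra closed_field.
From mathcomp Require Import mpoly freeg.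
(* boolp is not imported: its notations clash with those of mpoly. *)
From mathcomp Require boolp.
From Stdlib Require Import ClassicalEpsilon.

Set Implicit Arguments.
Unset Strict Implicit.
Unset Printing Implicit Defensive.

Import Order.TTheory GRing.Theory Num.Theory.
Local Open Scope ring_scope.

Definition Kbar (K : finFieldType) : closedFieldType :=
  projT1 (countable_algebraic_closure K).

Definition toKbar (K : finFieldType) : {rmorphism K -> Kbar K} :=
  sval (projT2 (countable_algebraic_closure K)).

Definition alg_indep (K L : fieldType) (phi : {rmorphism K -> L}) (n : nat)
    (x : 'I_n -> L) : Prop :=
  forall p : {mpoly K[n]}, mmap phi x p = 0 -> p = 0.

Definition has_trdeg (K L : fieldType) (phi : {rmorphism K -> L}) (n : nat) :
    Prop :=
  (exists x : 'I_n -> L, alg_indep phi x) /\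
  (forall x : 'I_n.+1 -> L, ~ alg_indep phi x).

(* The forms over K that vanish at the point with homogeneous coordinates x. *)
Definition vanishing_forms (K L : fieldType) (phi : {rmorphism K -> L})
    (n : nat) (x : 'I_n.+1 -> L) (h : {mpoly K[n.+1]}) : Prop :=
  (exists d, h \is d.-homog) /\ mmap phi x h = 0.

(* An integral projective curve X in P^N over K, presented by its generic     *)
(* point: if (x_0 : ... : x_N) are homogeneous coordinates of that point, with *)
(* entries in the function field K(X), then the homogeneous prime ideal of X  *)
(* is generated by the forms vanishing at x, and K(X) consists of the values  *)
(* at x of the quotients of two forms of the same degree.                     *)
Record proj_curve (K : finFieldType) := ProjCurve {
  amb_dim : nat;
  fun_field : fieldType;
  const : {rmorphism K -> fun_field};
  gen_pt : 'I_amb_dim.+1 -> fun_field;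
  gen_pt_neq0 : exists i, gen_pt i != 0;
  fun_fieldP : forall f : fun_field,
    exists d (a b : {mpoly K[amb_dim.+1]}),
      [/\ a \is d.-homog, b \is d.-homog, mmap const gen_pt b != 0
        & f = mmap const gen_pt a / mmap const gen_pt b];
  trdeg1 : has_trdeg const 1
}.
Arguments const {K} X : rename.
Arguments gen_pt {K} X i : rename.

(* Homogeneous coordinates of points of X over the algebraic closure. *)
Definition geom_pt (K : finFieldType) (X : proj_curve K)
    (c : 'I_(amb_dim X).+1 -> Kbar K) : Prop :=
  (exists i, c i != 0) /\
  (forall h, vanishing_forms (const X) (gen_pt X) h ->
             vanishing_forms (toKbar K) c h).
Arguments geom_pt {K} X c.

(* Irreducibility of X(Kbar) for the Zariski topology of P^N(Kbar). *)
Definition geom_irreducible (K : finFieldType) (X : proj_curve K) : Prop :=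
  forall (d e : nat) (a b : {mpoly (Kbar K)[(amb_dim X).+1]}),
    a \is d.-homog -> b \is e.-homog ->
    (forall c, geom_pt X c -> a.@[c] = 0 \/ b.@[c] = 0) ->
    (forall c, geom_pt X c -> a.@[c] = 0) \/
    (forall c, geom_pt X c -> b.@[c] = 0).

(* As in Proj, a closed point of X is a homogeneous prime ideal, given by its *)
(* set of forms: the forms over K vanishing at some geometric point.  Two     *)
(* geometric points conjugate over K define the same closed point.            *)
Definition closed_pt (K : finFieldType) (X : proj_curve K) : Type :=
  {p : {mpoly K[(amb_dim X).+1]} -> Prop |
    exists2 c, geom_pt X c & forall h, p h <-> vanishing_forms (toKbar K) c h}.

HB.instance Definition _ (K : finFieldType) (X : proj_curve K) :=
  boolp.gen_eqMixin (closed_pt X).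
HB.instance Definition _ (K : finFieldType) (X : proj_curve K) :=
  boolp.gen_choiceMixin (closed_pt X).

Definition rational_pt (K : finFieldType) (X : proj_curve K)
    (Q : closed_pt X) : Prop :=
  exists2 k : 'I_(amb_dim X).+1 -> K, (exists i, k i != 0) &
    forall h, sval Q h <-> vanishing_forms (toKbar K) (toKbar K \o k) h.

Definition local_ring (K : finFieldType) (X : proj_curve K) (Q : closed_pt X)
    (f : fun_field X) : Prop :=
  exists d (a b : {mpoly K[(amb_dim X).+1]}),
    [/\ a \is d.-homog, b \is d.-homog, ~ sval Q b
      & f = mmap (const X) (gen_pt X) a / mmap (const X) (gen_pt X) b].

Definition max_ideal (K : finFieldType) (X : proj_curve K) (Q : closed_pt X)
    (f : fun_field X) : Prop :=
  exists d (a b : {mpoly K[(amb_dim X).+1]}),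
    [/\ a \is d.-homog, b \is d.-homog, sval Q a, ~ sval Q b
      & f = mmap (const X) (gen_pt X) a / mmap (const X) (gen_pt X) b].

Definition uniformizer (K : finFieldType) (X : proj_curve K) (Q : closed_pt X)
    (t : fun_field X) : Prop :=
  max_ideal Q t /\
  (forall f, max_ideal Q f -> exists2 s, local_ring Q s & f = s * t).

(* Every local ring, which is of dimension 1, is regular. *)
Definition nonsingular (K : finFieldType) (X : proj_curve K) : Prop :=
  forall Q : closed_pt X, exists t, uniformizer Q t.

(* The order at Q of a nonzero function f = u t^n on a nonsingular curve, u a *)
(* unit of the local ring; ord Q 0 is meaningless.                            *)
Definition ord (K : finFieldType) (X : proj_curve K) (Q : closed_pt X)
    (f : fun_field X) : int :=
  epsilon (inhabits 0) (fun n : int => exists t u,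
    [/\ uniformizer Q t, local_ring Q u, ~ max_ideal Q u & f = u * t ^ n]).

Definition divisor (K : finFieldType) (X : proj_curve K) :=
  {freeg (closed_pt X) / int}.

Definition RR_space (K : finFieldType) (X : proj_curve K) (G : divisor X)
    (f : fun_field X) : Prop :=
  f = 0 \/ (forall Q, 0 <= ord Q f + coeff Q G).

(* V / W is of dimension n over K: the e i are a basis of V modulo W. *)
Definition has_dim (K : finFieldType) (X : proj_curve K)
    (V W : fun_field X -> Prop) (n : nat) : Prop :=
  exists e : 'I_n -> fun_field X,
    (forall i, V (e i)) /\
    (forall f, V f ->
       exists! k : {ffun 'I_n -> K}, W (f - \sum_i const X (k i) * e i)).

(* Meaningful for finite-dimensional V / W only. *)
Definition dimq (K : finFieldType) (X : proj_curve K)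
    (V W : fun_field X -> Prop) : nat :=
  epsilon (inhabits 0%N) (has_dim V W).

Definition RR_dim (K : finFieldType) (X : proj_curve K) (G : divisor X) : nat :=
  dimq (RR_space G) (fun f => f = 0).

(* The degree of a closed point is that of its residue field over K. *)
Definition pt_deg (K : finFieldType) (X : proj_curve K) (Q : closed_pt X) :
    nat :=
  dimq (local_ring Q) (max_ideal Q).

(* Not freeg.deg, which does not weight points by their degrees. *)
Definition div_deg (K : finFieldType) (X : proj_curve K) (G : divisor X) : int :=
  \sum_(Q <- dom G) coeff Q G * (pt_deg Q)%:Z.

(* g = max_G (deg G - dim L(G) + 1). *)
Definition has_genus (K : finFieldType) (X : proj_curve K) (g : nat) : Prop :=
  (forall G : divisor X, div_deg G - (RR_dim G)%:Z + 1 <= g%:Z) /\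
  (exists G : divisor X, div_deg G - (RR_dim G)%:Z + 1 = g%:Z).

Definition pts_div (K : finFieldType) (X : proj_curve K) (r : nat)
    (R : 'I_r -> closed_pt X) (u : {ffun 'I_r -> nat}) : divisor X :=
  \sum_i << (u i)%:Z *g R i >>.

Definition has_pole_divisor (K : finFieldType) (X : proj_curve K)
    (f : fun_field X) (G : divisor X) : Prop :=
  f != 0 /\ (forall Q, coeff Q G = Num.max 0 (- ord Q f)).

Definition semigroup (K : finFieldType) (X : proj_curve K) (r : nat)
    (R : 'I_r -> closed_pt X) (u : {ffun 'I_r -> nat}) : Prop :=
  exists f, has_pole_divisor f (pts_div R u).

Definition gap (K : finFieldType) (X : proj_curve K) (r : nat)
    (R : 'I_r -> closed_pt X) (u : {ffun 'I_r -> nat}) : Prop :=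
  ~ semigroup R u.

Definition nabla (K : finFieldType) (X : proj_curve K) (r : nat)
    (R : 'I_r -> closed_pt X) (i : 'I_r) (u p : {ffun 'I_r -> nat}) : Prop :=
  semigroup R p /\ p i = u i.

Definition lecomp (r : nat) (p u : {ffun 'I_r -> nat}) : Prop :=
  forall i, (p i <= u i)%N.

Definition minimal_in (r : nat) (S : {ffun 'I_r -> nat} -> Prop)
    (u : {ffun 'I_r -> nat}) : Prop :=
  S u /\ (forall p, S p -> lecomp p u -> p = u).

(* Used for r >= 2 only. *)
Definition min_gen_set (K : finFieldType) (X : proj_curve K) (r : nat)
    (R : 'I_r -> closed_pt X) (u : {ffun 'I_r -> nat}) : Prop :=
  (forall i, (0 < u i)%N) /\ (exists i, minimal_in (nabla R i u) u).

Definition pure_gap (K : finFieldType) (X : proj_curve K) (r : nat)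
    (R : 'I_r -> closed_pt X) (u : {ffun 'I_r -> nat}) : Prop :=
  gap R u /\
  (forall j, RR_dim (pts_div R u) = RR_dim (pts_div R u - << R j >>)).

(* Main.v *)
Require Import Defs.
From mathcomp Require Import all_boot all_order all_algebra ring zify.
From mathcomp Require Import mpoly freeg.
From mathcomp Require boolp.
From Stdlib Require Import ClassicalEpsilon.

Set Implicit Arguments.
Unset Strict Implicit.
Unset Printing Implicit Defensive.

Import Order.TTheory GRing.Theory Num.Theory.
Local Open Scope ring_scope.

(** Let [a] be minimal in [nabla P i a], and let [h] have pole divisor [A], the
    divisor of [a].  A function [f] in L(A) with a pole of order [a k] at some
    [P k] then has one of order [a j] at every [P j]: for [k = i] this is
    minimality, and otherwise, if the pole at [P i] were smaller, a suitable
    [h - c f] would contradict it.  Hence L(A - P_l) = L(A - P_l - P_k) for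
    [k <> l], which together with [eqL] makes all the dimensions equal; as
    [m >= 1], it also shows that no function has pole divisor A - P_l.  Neither
    Riemann-Roch nor the finiteness of L(G) plays a role.

    The orders are valuations because a uniformizer [t] satisfies
    [\bigcap_n t^n O = 0].  Instead of Krull's theorem, one uses that any two
    functions are algebraically dependent over the field of constants. *)

(** * The local ring at a closed point *)

Definition local_unit (K : finFieldType) (X : proj_curve K) (Q : closed_pt X)
  (f : fun_field X) : Prop := local_ring Q f /\ ~ max_ideal Q f.

Section ClosedPoint.
Variables (K : finFieldType) (X : proj_curve K) (Q : closed_pt X).
Implicit Types (f g s t u w : fun_field X) (a b : {mpoly K[(amb_dim X).+1]}).

Local Notation ev := (mmap (const X) (gen_pt X)).
Local Notation O := (local_ring Q).
Local Notation M := (max_ideal Q).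
Local Notation U := (local_unit Q).

Lemma closed_ptP : exists2 c, geom_pt X c &
  forall d a, a \is d.-homog -> (sval Q a <-> mmap (toKbar K) c a = 0).
Proof.
case: (svalP Q) => c cX QP; exists c => // d a a_hom.
by rewrite QP /vanishing_forms; split=> [[]|a0] //; split=> //; exists d.
Qed.

(** A form vanishing at the generic point vanishes at every geometric point. *)
Lemma closed_pt_ev_neq0 d b : b \is d.-homog -> ~ sval Q b -> ev b != 0.
Proof.
have [c [_ cX] QP] := closed_ptP.
move=> b_hom /(QP _ _ b_hom) b_c; apply/eqP => b0; apply: b_c.
by case: (cX b) => //; split=> //; exists d.
Qed.

Lemma closed_pt_notM d e a b : a \is d.-homog -> b \is e.-homog ->
  ~ sval Q a -> ~ sval Q b -> ~ sval Q (a * b).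
Proof.
have [c _ QP] := closed_ptP => a_hom b_hom a_c b_c.
rewrite (QP _ _ (dhomogM a_hom b_hom)) rmorphM /= => /eqP.
by rewrite mulf_eq0 => /orP[] /eqP; [rewrite -(QP d)|rewrite -(QP e)].
Qed.

Lemma local_ring_const k : O (const X k).
Proof.
have [c _ QP] := closed_ptP.
exists 0%N, k%:MP, 1; split; rewrite ?dhomog1 //.
- by rewrite -[_%:MP]mulr1 mul_mpolyC dhomogZ ?dhomog1.
- by rewrite (QP 0%N) ?dhomog1 // rmorph1; apply/eqP; apply: oner_neq0.
- by rewrite mmapC rmorph1 divr1.
Qed.

Lemma local_ring0 : O 0.
Proof. by rewrite -(rmorph0 (const X)); apply: local_ring_const. Qed.

Lemma local_ring1 : O 1.
Proof. by rewrite -(rmorph1 (const X)); apply: local_ring_const. Qed.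

Lemma local_ringM f g : O f -> O g -> O (f * g).
Proof.
case=> d [a] [b] [a_hom b_hom b_c ->] [e] [a'] [b'] [a'_hom b'_hom b'_c ->].
exists (d + e)%N, (a * a'), (b * b'); split; rewrite ?dhomogM //.
  exact: closed_pt_notM b_hom b'_hom b_c b'_c.
by rewrite !rmorphM /= invfM mulrACA.
Qed.

Lemma local_ringD f g : O f -> O g -> O (f + g).
Proof.
case=> d [a] [b] [a_hom b_hom b_c ->] [e] [a'] [b'] [a'_hom b'_hom b'_c ->].
exists (d + e)%N, (a * b' + b * a'), (b * b').
split; rewrite ?dhomogD ?dhomogM //.
  exact: closed_pt_notM b_hom b'_hom b_c b'_c.
have b0 := closed_pt_ev_neq0 b_hom b_c.
have b'0 := closed_pt_ev_neq0 b'_hom b'_c.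
by rewrite rmorphD !rmorphM /=; field; rewrite b0 b'0.
Qed.

Lemma local_ringX f n : O f -> O (f ^+ n).
Proof.
move=> Of; elim: n => [|n IHn]; first by rewrite expr0; apply: local_ring1.
by rewrite exprS; apply: local_ringM.
Qed.

Lemma max_ideal_local f : M f -> O f.
Proof. by case=> d [a] [b] [*]; exists d, a, b. Qed.

Lemma max_idealM f g : M f -> O g -> M (f * g).
Proof.
have [c _ QP] := closed_ptP.
case=> d [a] [b] [a_hom b_hom a_c b_c ->] [e] [a'] [b'] [a'_hom b'_hom b'_c ->].
exists (d + e)%N, (a * a'), (b * b'); split; rewrite ?dhomogM //.
- move: a_c; rewrite (QP _ _ a_hom) (QP _ _ (dhomogM a_hom a'_hom)) rmorphM /=.
  by move=> ->; rewrite mul0r.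
- exact: closed_pt_notM b_hom b'_hom b_c b'_c.
- by rewrite !rmorphM /= invfM mulrACA.
Qed.

(** If a / b = 1, then [a - b] vanishes at the generic point, hence at [Q]; so [b] would vanish at
    [Q] along with [a]. *)
Lemma max_ideal1 : ~ M 1.
Proof.
have [c [_ cX] QP] := closed_ptP.
case=> d [a] [b] [a_hom b_hom a_c b_c /eqP].
rewrite eq_sym -subr_eq0 => /eqP ab.
have b0 := closed_pt_ev_neq0 b_hom b_c.
have ab_hom : a - b \is d.-homog by rewrite rpredB.
have [|_] := cX (a - b).
  split; first by exists d.
  rewrite rmorphB /=; apply: (mulIf (invr_neq0 b0)).
  by rewrite mulrBl divff // mul0r.
move: a_c b_c; rewrite (QP _ _ a_hom) (QP _ _ b_hom) rmorphB /= => ->.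
by rewrite sub0r => b_c /eqP; rewrite oppr_eq0 => /eqP.
Qed.

Lemma local_unit_neq0 u : U u -> u != 0.
Proof.
have [c _ QP] := closed_ptP.
case=> -[d [a] [b] [a_hom b_hom b_c ->]] Mu; apply/eqP => u0; apply: Mu.
rewrite u0; exists d, 0, b; split=> //; rewrite ?rpred0 ?mmap0 ?mul0r //.
by rewrite (QP d) ?rpred0 // mmap0.
Qed.

Lemma local_unitV u : U u -> U u^-1.
Proof.
move=> Uu; have u0 := local_unit_neq0 Uu; case: Uu => Ou Mu; split.
  case: Ou Mu => d [a] [b] [a_hom b_hom b_c ->] Mu.
  exists d, b, a; split=> //; last by rewrite invfM invrK mulrC.
  by move=> a_c; apply: Mu; exists d, a, b.
move=> MV; apply: max_ideal1; rewrite -(mulVf u0); exact: max_idealM.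
Qed.

Lemma local_unitP u : u != 0 -> O u -> O u^-1 -> U u.
Proof.
move=> u0 Ou OV; split=> // Mu; apply: max_ideal1.
by rewrite -(divff u0); apply: max_idealM.
Qed.

Lemma local_unitM u w : U u -> U w -> U (u * w).
Proof.
move=> Uu Uw; apply: local_unitP.
- by rewrite mulf_neq0 ?local_unit_neq0.
- by apply: local_ringM; [case: Uu|case: Uw].
- rewrite invfM; apply: local_ringM.
    by case: (local_unitV Uu).
  by case: (local_unitV Uw).
Qed.

Lemma local_unitXz u (n : int) : U u -> U (u ^ n).
Proof.
move=> Uu.
have UX k : U (u ^+ k).
  elim: k => [|k IHk]; last by rewrite exprS; apply: local_unitM.
  by rewrite expr0; split; [apply: local_ring1|apply: max_ideal1].
by case: n => k; [apply: UX|apply: local_unitV; apply: UX].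
Qed.

Lemma local_unit_const k : k != 0 -> U (const X k).
Proof.
move=> k0; apply: local_unitP; first by rewrite fmorph_eq0.
  exact: local_ring_const.
by rewrite -fmorphV; apply: local_ring_const.
Qed.

(* A coordinate that does not vanish at [Q] dehomogenizes both forms. *)
Lemma local_ring_frac f : exists s w, [/\ O s, O w, w != 0 & f = s / w].
Proof.
have [c [[i ci0] cX] QP] := closed_ptP.
have [d [a] [b] [a_hom b_hom b0 ->]] := fun_fieldP f.
have xd_hom : 'X_i ^+ d \is [in K[_], d.-homog].
  by rewrite -[X in X.-homog]mul1n dhomogMn // dhomogX /= mdeg1.
have xd_c : ~ sval Q ('X_i ^+ d).
  rewrite (QP d) // rmorphXn /= mmapX mmap1U => /eqP.
  by rewrite expf_eq0 (negPf ci0) andbF.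
have xd0 := closed_pt_ev_neq0 xd_hom xd_c.
exists (ev a / ev ('X_i ^+ d)), (ev b / ev ('X_i ^+ d)); split.
- by exists d, a, ('X_i ^+ d).
- by exists d, b, ('X_i ^+ d).
- by rewrite mulf_neq0 ?invr_eq0.
- by field; rewrite b0 xd0.
Qed.

(* A polynomial relation between [f] and [t], divided by the largest possible
   power of [f], shows that [t ^+ N] lies in [f * O + t ^+ N.+1 * O] for some
   [N]. *)
Lemma max_ideal_separated t f : t != 0 -> M t -> f != 0 ->
  exists N, forall s, O s -> f <> s * t ^+ N.
Proof.
move=> t0 Mt f0.
have [p [p0 pn0]] : exists p : {mpoly K[2]},
    mmap (const X) (fun i : 'I_2 => if i == ord0 then f else t) p = 0 /\ p <> 0.
  apply: NNPP => nex; have [_ dep] := trdeg1 X.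
  apply: (dep (fun i : 'I_2 => if i == ord0 then f else t)) => p p0.
  by apply: NNPP => pn0; apply: nex; exists p.
(* [k] is the least exponent of [f] in [p], and [j] the least exponent of [t] among the monomials
   where [f] has exponent [k]; [m] attains both. *)
have ex_k : exists k, has (fun m : 'X_{1..2} => m ord0 == k) (msupp p).
  case: (msupp p) (msupp_eq0 p) => [|m r _]; first by rewrite eqxx => /esym/eqP.
  by exists (m ord0); rewrite /= eqxx.
case: (ex_minnP ex_k) => k /hasP[m1 m1p /eqP m1k] k_min {ex_k}.
have ex_j : exists j,
    has (fun m : 'X_{1..2} => (m ord0 == k) && (m ord_max == j)) (msupp p).
  by exists (m1 ord_max); apply/hasP; exists m1; rewrite ?m1k ?eqxx.
case: (ex_minnP ex_j) => j /hasP[m mp /andP[/eqP mk /eqP mj]] j_min.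
clear ex_j m1 m1p m1k.
exists j.+1 => s Os fE.
move: p0; rewrite /mmap (bigD1_seq m) ?msupp_uniq //=.
have mmap1E (n : 'X_{1..2}) :
    mmap1 (fun i : 'I_2 => if i == ord0 then f else t) n
    = f ^+ n ord0 * t ^+ n ord_max.
  rewrite /mmap1 !big_ord_recl big_ord0 /= mulr1.
  by congr (_ * t ^+ n _); apply/val_inj.
(* Since f = s t^(j+1), every other monomial is a multiple of f^k t^(j+1): through its power of [t],
   or through an extra factor [f]. *)
have [w Ow ->] : exists2 w, O w & \sum_(n <- msupp p | n != m)
    const X p@_n * mmap1 (fun i : 'I_2 => if i == ord0 then f else t) n
    = f ^+ k * t ^+ j.+1 * w.
  rewrite big_seq_cond.
  apply: (big_ind (fun x => exists2 w, O w & x = f ^+ k * t ^+ j.+1 * w)).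
  - by exists 0; [apply: local_ring0|rewrite mulr0].
  - move=> _ _ [w1 O1 ->] [w2 O2 ->]; exists (w1 + w2); last by rewrite mulrDr.
    exact: local_ringD.
  - move=> n /andP[np nm]; rewrite mmap1E.
    have Ot := max_ideal_local Mt.
    have kn : (k <= n ord0)%N by apply: k_min; apply/hasP; exists n.
    have [nk|nk] := eqVneq (n ord0) k.
      have jn : (j < n ord_max)%N.
        rewrite ltn_neqAle j_min ?andbT; last first.
          by apply/hasP; exists n; rewrite ?nk ?eqxx.
        apply: contra nm => /eqP nj; apply/eqP/mnmP => i.
        case: (unliftP ord0 i) => [i' ->|->]; last by rewrite nk mk.
        have -> : fintype.lift ord0 i' = ord_max :> 'I_2.
          by apply/val_inj; case: i' => -[].
        by rewrite mj -nj.
      exists (const X p@_n * t ^+ (n ord_max - j.+1)).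
        by apply: local_ringM; [apply: local_ring_const|apply: local_ringX].
      by rewrite -{1}(subnKC jn) nk exprD; ring.
    have {}nk : (k < n ord0)%N by rewrite ltn_neqAle eq_sym nk.
    exists (const X p@_n * s * f ^+ (n ord0 - k.+1) * t ^+ n ord_max).
      have Of : O f by rewrite fE; apply: local_ringM => //; apply: local_ringX.
      do ?apply: local_ringM => //; try exact: local_ringX.
      exact: local_ring_const.
    rewrite -{1}(subnKC nk) exprD exprSr.
    by rewrite [in X in _ * (_ * X * _ * _)]fE; ring.
rewrite mmap1E mk mj exprSr => /eqP.
rewrite [X in X == 0](_ : _ = f ^+ k * t ^+ j * (const X p@_m + t * w));
  last by ring.
rewrite mulf_eq0 mulf_eq0 !expf_eq0 (negPf f0) (negPf t0) !andbF /=.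
(* Dividing by f^k t^j has left a relation that puts a nonzero constant in the maximal ideal. *)
rewrite addrC addr_eq0 => /eqP twE.
have [|_] := local_unit_const (k := - p@_m).
  by rewrite oppr_eq0 -mcoeff_msupp.
by apply; rewrite rmorphN /= -twE; apply: max_idealM.
Qed.

End ClosedPoint.

(** * The order at a closed point as a valuation *)

Section Order.
Variables (K : finFieldType) (X : proj_curve K) (Q : closed_pt X).
Hypothesis X_nonsing : nonsingular X.
Implicit Types (f g s t u w : fun_field X) (n : int).

Local Notation O := (local_ring Q).
Local Notation M := (max_ideal Q).
Local Notation U := (local_unit Q).

(** Induction on an [N] with [f] outside t^N O: each division by [t] lowers [N], so the divisions
    end at a unit. *)
Lemma local_ring_factor t f : uniformizer Q t -> O f -> f != 0 ->
  exists (n : nat) u, U u /\ f = u * t ^+ n.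
Proof.
case=> Mt tP Of f0.
have [N sepN] : exists N, forall s, O s -> f <> s * t ^+ N.
  have [t0|t0] := eqVneq t 0; last exact: max_ideal_separated Mt f0.
  (* For [t = 0] the ideal t O is already zero. *)
  by exists 1%N => s _ fE; rewrite fE t0 expr1 mulr0 eqxx in f0.
elim: N f Of f0 sepN => [|N IHN] f Of f0 sepN.
  by case: (sepN f Of); rewrite expr0 mulr1.
have [Mf|nMf] := classic (M f); last first.
  by exists 0%N, f; split; [split|rewrite expr0 mulr1].
have [s Os fE] := tP f Mf.
have s0 : s != 0 by apply: contraNneq f0 => s0; rewrite fE s0 mul0r.
have [|n [u [Uu sE]]] := IHN s Os s0.
  by move=> r Or sE; apply: (sepN r Or); rewrite fE sE exprSr mulrA.
by exists n.+1, u; split=> //; rewrite fE sE exprSr mulrA.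
Qed.

Lemma uniformizer_factor t f : uniformizer Q t -> f != 0 ->
  exists n u, U u /\ f = u * t ^ n.
Proof.
move=> tP f0; have [s [w [Os Ow w0 fE]]] := local_ring_frac Q f.
have s0 : s != 0 by apply: contraNneq f0 => s0; rewrite fE s0 mul0r.
have [n [u [Uu sE]]] := local_ring_factor tP Os s0.
have [k [v [Uv wE]]] := local_ring_factor tP Ow w0.
have [t0|t0] := eqVneq t 0; last first.
  exists (n%:Z - k%:Z), (u / v); split.
    by apply: local_unitM => //; apply: local_unitV.
  by rewrite fE sE wE expfzDr // -invr_expz invfM mulrACA.
exists 0, (u / v); split.
  by apply: local_unitM => //; apply: local_unitV.
move: sE wE s0 w0; rewrite t0 !expr0n.
case: n => [|n] sE; last by rewrite sE mulr0 eqxx.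
case: k => [|k] wE; last by rewrite wE mulr0 eqxx.
by rewrite fE sE wE !mulr1.
Qed.

(** Each uniformizer is a multiple of the other, and the cofactors are mutually inverse unless both
    uniformizers are 0. *)
Lemma uniformizer_eq t t' : uniformizer Q t -> uniformizer Q t' ->
  exists2 s, U s & t' = s * t.
Proof.
case=> Mt tP [Mt' t'P].
have [s Os t'E] := tP t' Mt'; have [s' Os' tE] := t'P t Mt.
have [t0|t0] := eqVneq t 0.
  exists 1; last by rewrite t'E t0 !mulr0.
  by split; [apply: local_ring1|apply: max_ideal1].
exists s => //; have ss' : s' * s = 1.
  by apply: (mulIf t0); rewrite mul1r -mulrA -t'E.
have s0 : s != 0.
  by apply: contra_eqN ss' => /eqP->; rewrite mulr0 eq_sym oner_eq0.
apply: local_unitP => //; rewrite (_ : s^-1 = s') //.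
by apply: (mulIf s0); rewrite mulVf.
Qed.

(** [ord] is chosen along with some unknown uniformizer; passing from that one to [t] changes only
    the unit. *)
Lemma ordE t f : uniformizer Q t -> f != 0 ->
  exists2 u, U u & f = u * t ^ ord Q f.
Proof.
move=> tP f0.
have : exists n t u, [/\ uniformizer Q t, O u, ~ M u & f = u * t ^ n].
  have [n [u [[Ou Mu] fE]]] := uniformizer_factor tP f0.
  by exists n, t, u.
move=> /(epsilon_spec (inhabits 0)) /=; rewrite -/(ord Q f).
case=> t' [u] [t'P Ou Mu fE]; have [s Us t'E] := uniformizer_eq tP t'P.
exists (u * s ^ ord Q f); last by rewrite {1}fE t'E expfzMl mulrA.
by apply: local_unitM; [split|apply: local_unitXz].
Qed.

(* The local ring is a field when [t = 0]. *)
Lemma ord_trivial f : uniformizer Q 0 -> f != 0 -> ord Q f = 0.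
Proof.
move=> tP f0; have [u _] := ordE tP f0.
have [-> //|n0 fE] := eqVneq (ord Q f) 0.
by move: f0; rewrite fE exp0rz (negPf n0) mulr0 eqxx.
Qed.

(** Two exponents for the same function would differ by some d with t^d a unit; as [t] lies in the
    maximal ideal, d = 0. *)
Lemma ord_unique t u n : uniformizer Q t -> t != 0 -> U u ->
  ord Q (u * t ^ n) = n.
Proof.
move=> tP t0 Uu; set f := _ * _.
have f0 : f != 0 by rewrite mulf_neq0 ?expfz_neq0 ?(local_unit_neq0 Uu).
have [w Uw fE] := ordE tP f0.
have notUX (k : int) : U (t ^ k) -> k = 0.
  have notU k' : ~ U (t ^+ k'.+1).
    case=> _; apply; rewrite exprS; apply: max_idealM; first by case: tP.
    by apply: local_ringX; apply: max_ideal_local; case: tP.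
  case: k => k; first by case: k => // k /notU.
  by move=> /local_unitV; rewrite NegzE -exprnN invrK => /notU.
apply/eqP; rewrite -subr_eq0; apply/eqP/notUX.
have -> : t ^ (ord Q f - n) = u / w.
  have := local_unit_neq0 Uw; have := local_unit_neq0 Uu => u0 w0.
  rewrite expfzDr // -invr_expz; apply: (mulIf (expfz_neq0 n t0)).
  rewrite mulrAC -[_ * _ * _]mulrA divff ?expfz_neq0 // mulr1.
  by apply: (mulfI w0); rewrite -fE /f; field.
by apply: local_unitM => //; apply: local_unitV.
Qed.

Lemma ordM f g : f != 0 -> g != 0 -> ord Q (f * g) = ord Q f + ord Q g.
Proof.
move=> f0 g0; have [t tP] := X_nonsing Q.
have [t0|t0] := eqVneq t 0.
  by rewrite !ord_trivial ?mulf_neq0 // -t0.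
have [u Uu fE] := ordE tP f0; have [w Uw gE] := ordE tP g0.
rewrite {1}fE {1}gE mulrACA -expfzDr //.
by apply: ord_unique => //; apply: local_unitM.
Qed.

Lemma ord_div f g : f != 0 -> g != 0 -> ord Q (g / f) = ord Q g - ord Q f.
Proof.
move=> f0 g0; have gf0 : g / f != 0 by rewrite mulf_neq0 ?invr_eq0.
by rewrite -{2}(divfK f0 g) (ordM gf0 f0) addrK.
Qed.

Lemma ord_ge0 f : f != 0 -> 0 <= ord Q f <-> O f.
Proof.
move=> f0; have [t tP] := X_nonsing Q; have [u [Ou Mu] fE] := ordE tP f0.
have Mt : M t by case: tP.
case: (ord Q f) fE => k fE.
  split=> // _; rewrite fE; apply: local_ringM => //.
  exact/local_ringX/max_ideal_local.
split=> // Of.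
have t0 : t != 0.
  by apply: contraNneq f0 => t0; rewrite fE t0 NegzE exp0rz mulr0.
(* At order -(k+1), the unit [u] is t^(k+1) f, which lies in the maximal ideal once [f] is in the
   local ring. *)
case: Mu; have -> : u = t * t ^+ k * f.
  by rewrite fE NegzE -exprnN -exprS mulrCA mulfV ?mulr1 // expf_neq0.
rewrite -mulrA; apply: max_idealM => //; apply: local_ringM => //.
exact/local_ringX/max_ideal_local.
Qed.

Lemma ord_gt0 f : f != 0 -> M f -> 0 < ord Q f.
Proof.
move=> f0 Mf; have := (ord_ge0 f0).2 (max_ideal_local Mf).
rewrite le_eqVlt => /orP[/eqP f_ord|//].
have [t tP] := X_nonsing Q; have [u [Ou Mu]] := ordE tP f0.
by rewrite -f_ord expr0z mulr1 => fE; case: Mu; rewrite -fE.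
Qed.

(** The orders of [k] and of its inverse are nonnegative and add up to the order of 1, which is
    0. *)
Lemma ord_const (k : K) : k != 0 -> ord Q (const X k) = 0.
Proof.
move=> k0; have ge0 (c : K) : c != 0 -> 0 <= ord Q (const X c).
  by move=> c0; apply/ord_ge0; [rewrite fmorph_eq0|apply: local_ring_const].
have kV0 : k^-1 != 0 by rewrite invr_eq0.
have e1 : ord Q 1 = ord Q 1 + ord Q 1 by rewrite -ordM ?oner_neq0 // mulr1.
have e2 : ord Q 1 = ord Q (const X k) + ord Q (const X k^-1).
  by rewrite -ordM ?fmorph_eq0 // -rmorphM divff // rmorph1.
by have := ge0 _ k0; have := ge0 _ kV0; lia.
Qed.

(** The case [f = 0] gives the zero function infinite order, so that the condition is stable under
    sums. *)
Definition ord_geq n f : Prop := f = 0 \/ n <= ord Q f.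

(** Write f + g = f (1 + g / f); if [f] has the smaller order, then g / f lies in the local ring. *)
Lemma ord_geqD n f g : ord_geq n f -> ord_geq n g -> ord_geq n (f + g).
Proof.
case=> [->|nf] [->|ng]; rewrite ?add0r ?addr0; try by [left|right].
have [->|f0] := eqVneq f 0; first by rewrite add0r; right.
have [->|g0] := eqVneq g 0; first by rewrite addr0; right.
wlog fg : f g f0 g0 nf ng / ord Q f <= ord Q g.
  move=> wlog_fg; have [|/ltW] := leP (ord Q f) (ord Q g); first exact: wlog_fg.
  by rewrite addrC; apply: wlog_fg.
have gf0 : g / f != 0 by rewrite mulf_neq0 ?invr_eq0.
have [->|fg0] := eqVneq (f + g) 0; [by left|right].
have fgE : f + g = f * (1 + g / f) by field.
have gf1 : 1 + g / f != 0 by apply: contraNneq fg0 => h0; rewrite fgE h0 mulr0.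
rewrite fgE ordM //; suff: 0 <= ord Q (1 + g / f) by lia.
apply/ord_ge0 => //; apply: local_ringD; first exact: local_ring1.
by apply/ord_ge0 => //; rewrite ord_div //; lia.
Qed.

Lemma ord_geqZ n (k : K) f : ord_geq n f -> ord_geq n (const X k * f).
Proof.
have [->|k0] := eqVneq k 0; first by rewrite rmorph0 mul0r; left.
case=> [->|nf]; first by rewrite mulr0; left.
have [->|f0] := eqVneq f 0; first by rewrite mulr0; left.
by right; rewrite ordM ?fmorph_eq0 // ord_const // add0r.
Qed.

(** The residue of a / b is a(c) / b(c), where [c] has coordinates in [K]. *)
Lemma rational_residue f : rational_pt Q -> O f ->
  exists k : K, M (f - const X k).
Proof.
case=> c _ QP [d] [a] [b] [a_hom b_hom b_c fE].
have evP h : h \is d.-homog -> (sval Q h <-> h.@[c] = 0).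
  have evE : mmap (toKbar K) (toKbar K \o c) h = toKbar K h.@[c].
    rewrite /meval /mmap rmorph_sum; apply: eq_bigr => m _ /=.
    rewrite rmorphM /mmap1 rmorph_prod; congr (_ * _).
    by apply: eq_bigr => i _; rewrite rmorphXn.
  move=> h_hom; rewrite QP /vanishing_forms evE; split=> [[_ /eqP]|->].
    by rewrite fmorph_eq0 => /eqP.
  by rewrite rmorph0; split=> //; exists d.
have b_c0 : b.@[c] != 0 by apply/eqP => b_c0; apply/b_c/evP.
exists (a.@[c] / b.@[c]), d, (a - (a.@[c] / b.@[c]) *: b), b.
have hom : a - (a.@[c] / b.@[c]) *: b \is d.-homog by rewrite rpredB ?dhomogZ.
split=> //.
  by apply/evP => //; rewrite mevalB mevalZ divfK // subrr.
have b0 := closed_pt_ev_neq0 b_hom b_c.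
by rewrite fE mmapB mmapZ mulrBl mulfK.
Qed.

(** [k] is the residue of g / f, which has order 0; it cancels the leading terms. *)
Lemma rational_ord_cancel f g : rational_pt Q -> f != 0 -> g != 0 ->
  ord Q f = ord Q g -> exists k : K, ord_geq (ord Q f + 1) (g - const X k * f).
Proof.
move=> Q_rat f0 g0 fg; have gf0 : g / f != 0 by rewrite mulf_neq0 ?invr_eq0.
have [|k Mk] := rational_residue (f := g / f) Q_rat.
  by apply/ord_ge0 => //; rewrite ord_div // fg subrr.
exists k; have -> : g - const X k * f = f * (g / f - const X k) by field.
have [->|r0] := eqVneq (g / f - const X k) 0; first by left; rewrite mulr0.
by right; rewrite ordM //; have := ord_gt0 r0 Mk; lia.
Qed.

End Order.

(** Moves the case [f = 0] under the quantifier, so that [ord_geqD] and [ord_geqZ] apply point by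
    point. *)
Lemma RR_spaceP (K : finFieldType) (X : proj_curve K) (G : divisor X)
    (f : fun_field X) :
  RR_space G f <-> forall Q, ord_geq Q (- coeff Q G) f.
Proof.
split=> [[->|fG] Q|fG]; first by left.
  by right; have := fG Q; lia.
have [->|/eqP f0] := eqVneq f 0; [by left|right=> Q].
by case: (fG Q) => // ?; lia.
Qed.

(** * Poles at the rational points [P k] *)

Section RationalPoints.
Variables (K : finFieldType) (X : proj_curve K) (r : nat).
Variable P : 'I_r -> closed_pt X.
Hypotheses (X_nonsing : nonsingular X) (P_inj : injective P).
Hypothesis P_rat : forall i, rational_pt (P i).
Implicit Types (f h : fun_field X) (u p a : {ffun 'I_r -> nat}).

Lemma coeff_pts_div u k : coeff (P k) (pts_div P u) = (u k)%:Z.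
Proof.
rewrite raddf_sum (bigD1 k) //= coeffU eqxx mulr1 big1 ?addr0 // => i ik.
by rewrite coeffU (inj_eq P_inj) (negPf ik) mulr0.
Qed.

Lemma coeff_pts_div_out u Q : (forall k, P k != Q) ->
  coeff Q (pts_div P u) = 0.
Proof.
move=> QP; rewrite raddf_sum big1 //= => i _.
by rewrite coeffU (negPf (QP i)) mulr0.
Qed.

(** Away from the [P k], such an [f] has no pole, so its pole divisor is given by a vector. *)
Lemma pole_vector a f : f != 0 -> RR_space (pts_div P a) f ->
  exists p, [/\ semigroup P p, lecomp p a
    & forall k, (p k)%:Z = Num.max 0 (- ord (P k) f)].
Proof.
move=> f0 [/eqP|fa]; first by rewrite (negPf f0).
have [p pE] : exists p : {ffun 'I_r -> nat}, forall k,
    (p k)%:Z = Num.max 0 (- ord (P k) f).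
  exists [ffun k => absz (Num.max 0 (- ord (P k) f))] => k.
  by rewrite ffunE; lia.
exists p; split=> //.
  exists f; split=> // Q.
  have [[k <-]|nQ] := classic (exists k, P k = Q).
    by rewrite coeff_pts_div.
  have QP k : P k != Q by apply/eqP => kQ; apply: nQ; exists k.
  by have := fa Q; rewrite !coeff_pts_div_out //; lia.
by move=> k; have := fa (P k); rewrite coeff_pts_div; have := pE k; lia.
Qed.

(* If some [f] violates this, subtracting a multiple of it from a function [h]
   with pole divisor [a] lowers the pole of [h] at [P k] and keeps the one at
   the index where [a] is minimal. *)
Lemma min_gen_set_ord a f k : min_gen_set P a -> f != 0 ->
    RR_space (pts_div P a) f -> ord (P k) f = - (a k)%:Z ->
  forall j, ord (P j) f = - (a j)%:Z.
Proof.
case=> a_gt0 [i [[[h [h0 h_poles]] _] a_min]].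
(* The pole vector of [f'] is below [a] and agrees with it at [i], hence equals [a]; as [a j] is
   positive, the maximum with 0 is the pole order itself. *)
have min_ord f' : f' != 0 -> RR_space (pts_div P a) f' ->
    ord (P i) f' = - (a i)%:Z -> forall j, ord (P j) f' = - (a j)%:Z.
  move=> f'0 f'a f'i j; have [p [p_semi pa pE]] := pole_vector f'0 f'a.
  have pi : p i = a i by have := pE i; lia.
  have pE' : p = a by apply: a_min.
  by have := pE j; have := a_gt0 j; rewrite pE'; lia.
have h_ord j : ord (P j) h = - (a j)%:Z.
  by have := h_poles (P j); have := a_gt0 j; rewrite coeff_pts_div; lia.
move=> f0 fa fk; apply: (min_ord f) => //; apply/eqP; apply: contraT => fi.
have [|c hc] := rational_ord_cancel X_nonsing (P_rat k) f0 h0.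
  by rewrite fk h_ord.
set h' := h - _ in hc.
have cE : - (const X c * f) = const X (- c) * f by rewrite rmorphN mulNr.
have h'a : RR_space (pts_div P a) h'.
  apply/RR_spaceP => Q; rewrite /h' cE.
  apply: (ord_geqD X_nonsing); last exact/ord_geqZ/(RR_spaceP _ _).1.
  by right; have := h_poles Q; lia.
have fi_gt : ord_geq (P i) (- (a i)%:Z + 1) f.
  have /RR_spaceP /(_ (P i)) := fa; rewrite coeff_pts_div.
  by case=> [->|?]; [left|right; lia].
(* Otherwise h = h' + c f would have a pole of order less than [a i] at [P i]. *)
have h'i : ~ ord_geq (P i) (- (a i)%:Z + 1) h'.
  move=> h'i; have := ord_geqD X_nonsing h'i (ord_geqZ X_nonsing c fi_gt).
  by rewrite subrK; case=> [/eqP|]; [rewrite (negPf h0)|rewrite h_ord; lia].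
have h'0 : h' != 0 by apply: contra_notN h'i => /eqP ->; left.
have h'i_ord : ord (P i) h' = - (a i)%:Z.
  have /RR_spaceP /(_ (P i)) := h'a; rewrite coeff_pts_div.
  case=> [/eqP|?]; first by rewrite (negPf h'0).
  apply/eqP; apply: contraT => ?; case: h'i; right; lia.
(* By minimality [h'] has a pole of order [a k] at [P k], but the choice of [c] has lowered that
   pole. *)
have := min_ord h' h'0 h'a h'i_ord k.
by case: hc => [/eqP|]; [rewrite (negPf h'0)|rewrite fk; lia].
Qed.

(** A pole of order [a k] at [P k] would force one of order [a l] at [P l], which is excluded. *)
Lemma min_gen_set_RR_space a l k f : min_gen_set P a -> k != l ->
  RR_space (pts_div P a - << P l >>) f ->
  RR_space (pts_div P a - << P l >> - << P k >>) f.
Proof.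
move=> a_Gamma kl fal; have [->|f0] := eqVneq f 0; first by left.
case: fal => [/eqP|fal]; first by rewrite (negPf f0).
have fa : RR_space (pts_div P a) f.
  by right=> Q; have := fal Q; rewrite coeffB coeffU; case: eqP => _; lia.
have fk : ord (P k) f != - (a k)%:Z.
  apply/eqP => fk; have := min_gen_set_ord a_Gamma f0 fa fk l.
  by have := fal (P l); rewrite coeffB coeffU coeff_pts_div eqxx; lia.
right=> Q; have := fal Q; rewrite !coeffB !coeffU.
have [<-|_] := eqVneq (P k) Q; last by rewrite mulr0 subr0.
by rewrite coeff_pts_div (inj_eq P_inj) eq_sym (negPf kl); move: fk; lia.
Qed.

End RationalPoints.

(** * Lowering one coordinate of a minimal generator *)

Theorem proposition4p2 (K : finFieldType) (X : proj_curve K)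
    (X_nonsing : nonsingular X) (X_girr : geom_irreducible X)
    (g : nat) (X_genus : has_genus X g) (g_ge1 : (1 <= g)%N)
    (m : nat) (m_ge1 : (1 <= m)%N)
    (P : 'I_m.+1 -> closed_pt X) (P_inj : injective P)
    (P_rat : forall i, rational_pt (P i))
    (a : {ffun 'I_m.+1 -> nat}) (a_Gamma : min_gen_set P a)
    (l : 'I_m.+1)
    (eqL : forall f : fun_field X,
       RR_space (pts_div P a - << P l >>) f <->
       RR_space (pts_div P a - << P l >> *+ 2) f) :
  pure_gap P [ffun i => if i == l then (a i - 1)%N else a i].
Proof.
set u := [ffun i => _].
have a_gt0 := a_Gamma.1.
(* The truncated subtraction at [l] is exact because [a l] is positive. *)
have uE : pts_div P u = pts_div P a - << P l >>.
  apply/eqP/freeg_eqP => Q; rewrite coeffB coeffU.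
  have [[k <-]|nQ] := classic (exists k, P k = Q).
    rewrite !coeff_pts_div // ffunE (inj_eq P_inj) [l == k]eq_sym.
    by have [->|_] := eqVneq k l; have := a_gt0 l; lia.
  have QP k : P k != Q by apply/eqP => kQ; apply: nQ; exists k.
  by rewrite !coeff_pts_div_out // (negPf (QP l)); lia.
have RR_eq k f : RR_space (pts_div P a - << P l >>) f ->
    RR_space (pts_div P a - << P l >> - << P k >>) f.
  have [->|kl] := eqVneq k l; last exact: min_gen_set_RR_space.
  by rewrite eqL mulr2n opprD addrA.
split.
- case=> f [f0 f_poles].
  (* At a second index [k], [f] has a pole of order exactly [a k], yet [RR_eq] allows at most
     [a k - 1]. *)
  have [k kl] : exists k : 'I_m.+1, k != l.
    have [l0|l0] := eqVneq l ord0; last by exists ord0; rewrite eq_sym.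
    by exists (inord 1); rewrite l0 -val_eqE /= inordK.
  have fu : RR_space (pts_div P u) f by right=> Q; rewrite f_poles; lia.
  rewrite uE in fu; have := RR_eq k f fu; rewrite -uE.
  case=> [/eqP|/(_ (P k))]; first by rewrite (negPf f0).
  have := f_poles (P k); rewrite coeffB coeffU eqxx coeff_pts_div //.
  by rewrite ffunE (negPf kl); have := a_gt0 k; lia.
(* The two spaces are equal as predicates, so [dimq] takes the same value on both. *)
move=> k; rewrite uE; congr (dimq _ _); apply: boolp.funext => f.
apply: boolp.propext; split; first exact: RR_eq.
case=> [->|fk]; first by left.
right=> Q; have := fk Q; rewrite coeffB [coeff Q << P k >>]coeffU.
by case: eqP => _; lia.
Qed.
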